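(* Let $\asymp$ be the relation of deterministic equivalence between sequences of matrices defined in the context. Below, $A_n,B_n,C_n,D_n$ denote sequences of deterministic or random matrices. The relation has the following properties. 1. (Equivalence) $\asymp$ is an equivalence relation. 2. (Sum) If $A_n\asymp B_n$ and $C_n\asymp D_n$, then $A_n+C_n\asymp B_n+D_n$. 3. (Product) If $A_n$ is a sequence of (deterministic or random) matrices with bounded operator norms, i.e. $\limsup_n\|A_n\|_{op}<\infty$, and $B_n\asymp C_n$, then $A_nB_n\asymp A_nC_n$. 4. (Trace) If $A_n\asymp B_n$ with $A_n,B_n$ of size $n\times n$, then $\operatorname{tr}\{n^{-1}A_n\}-\operatorname{tr}\{n^{-1}B_n\}\to0$ almost surely. 5. (Stieltjes transforms) As a consequence, if $(A_n-zI_n)^{-1}\asymp(B_n-zI_n)^{-1}$ for symmetric $n\times n$ matrices $A_n,B_n$, then $m_{A_n}(z)-m_{B_n}(z)\to0$ almost surely, where $m_{M}(z)=n^{-1}\operatorname{tr}(M-zI_n)^{-1}$ is the Stieltjes transform of the empirical spectral distribution of the $n\times n$ symmetric matrix $M$.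
   Context: Two sequences $A_n,B_n$ of (deterministic or random, not necessarily symmetric) square matrices of growing dimensions, $A_n$ and $B_n$ having the same size for each $n$, are called equivalent, written $A_n\asymp B_n$, if $$\lim_{n\to\infty}\left|\operatorname{tr}[E_n(A_n-B_n)]\right|=0\quad\text{almost surely}$$ for every standard sequence $E_n$, i.e. every sequence of deterministic, not necessarily symmetric matrices (of matching size) with bounded trace norm: $\limsup_n\|E_n\|_{tr}<\infty$. Here $\|M\|_{tr}=\operatorname{tr}((M^\top M)^{1/2})$ is the sum of the singular values of $M$, and $\|M\|_{op}$ is the operator norm. In items involving several sequences, all matrices with index $n$ have the same size. In item 5, $z$ is such that the inverses are defined (e.g. $z$ with positive imaginary part).
   Formalization: In item 3 with random A_n, the sequence (A_n) is additionally assumed independent of (B_n − C_n); without this the claim fails, e.g. B_n = n^{-1/2} s e_1^T, C_n = 0, A_n = n^{-1/2} e_1 s^T with s iid random signs. Deterministic A_n needs no extra assumption. *)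

(* Defs.v *)
From HB Require Import structures.
From mathcomp Require Import all_boot all_order all_algebra.
From mathcomp Require Import complex.
From mathcomp Require Import all_classical all_reals all_analysis.
Import Order.TTheory GRing.Theory Num.Theory.
Import numFieldNormedType.Exports.

Set Implicit Arguments.
Unset Strict Implicit.
Unset Printing Implicit Defensive.

Local Open Scope classical_set_scope.
Local Open Scope ring_scope.

(* The matrices related by deterministic equivalence are real or complex
   (resolvents at non-real points are complex); the test matrices are real and
   are mapped into K by iota. *)
Inductive scalar_embedding (R : realType) :
    forall K : numFieldType, (R -> K) -> Prop :=
  | real_scalars : @scalar_embedding R R idfun
  | complex_scalars : @scalar_embedding R R[i] (real_complex R).

Definition psdmx (R : realType) (n : nat) (S : 'M[R]_n) : Prop :=
  S^T = S /\ forall x : 'cV[R]_n, 0 <= (x^T *m S *m x) 0 0.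

(* Junk value 0 when N is not positive semidefinite; otherwise the square root
   exists and is unique. *)
Definition sqrtmx (R : realType) (n : nat) (N : 'M[R]_n) : 'M[R]_n :=
  xget 0 [set S | psdmx S /\ S *m S = N].

Definition trace_norm (R : realType) (n : nat) (M : 'M[R]_n) : R :=
  \tr (sqrtmx (M^T *m M)).

Definition sqnorm (K : numFieldType) (n : nat) (x : 'cV[K]_n) : K :=
  \sum_(i < n) `|x i 0| ^+ 2.

(* The supremum of the Euclidean norms r of M x over the unit vectors x; it is
   0 when n = 0. *)
Definition op_norm (R : realType) (K : numFieldType) (iota : R -> K) (n : nat)
    (M : 'M[K]_n) : R :=
  sup [set r : R | 0 <= r /\
    exists2 x : 'cV[K]_n, sqnorm x = 1 & sqnorm (M *m x) = iota (r ^+ 2)].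

Definition bounded_seq (R : realType) (u : nat -> R) : Prop :=
  (limn_esup (fun n => (u n)%:E) < +oo)%E.

Definition standard (R : realType) (d : nat -> nat)
    (E : forall n, 'M[R]_(d n)) : Prop :=
  bounded_seq (fun n => trace_norm (E n)).

Definition cvg_as (R : realType) (disp : measure_display)
    (T : measurableType disp) (P : probability T R) (K : numFieldType)
    (X : nat -> T -> K) (l : K) : Prop :=
  {ae P, forall w, X n w @[n --> \oo] --> l}.

Definition det_equiv (R : realType) (disp : measure_display)
    (T : measurableType disp) (P : probability T R) (K : numFieldType)
    (iota : R -> K) (d : nat -> nat) (A B : forall n, T -> 'M[K]_(d n)) : Prop :=
  forall E : (forall n, 'M[R]_(d n)), standard E ->
    cvg_as P (fun n w => `|\tr (map_mx iota (E n) *m (A n w - B n w))|) 0.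

(* The events generating the sigma-algebra of the whole sequence X. *)
Definition entry_events (disp : measure_display) (T : measurableType disp)
    (K : numFieldType) (d : nat -> nat) (X : forall n, T -> 'M[K]_(d n)) :
    set (set T) :=
  [set F | exists n (i j : 'I_(d n)) (U : set K),
     open U /\ F = [set w | U (X n w i j)]].

Definition random_mxseq (disp : measure_display) (T : measurableType disp)
    (K : numFieldType) (d : nat -> nat) (X : forall n, T -> 'M[K]_(d n)) : Prop :=
  entry_events X `<=` measurable.

(* Multiplying by a random sequence on the left preserves det_equiv only if the
   factor is independent of the difference: for iid sign vectors s of length n,
   n^(-1/2) s e_1^T is equivalent to 0 while
   (n^(-1/2) e_1 s^T) (n^(-1/2) s e_1^T) = e_1 e_1^T is not. *)
Definition independent_mxseq (R : realType) (disp : measure_display)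
    (T : measurableType disp) (P : probability T R) (K : numFieldType)
    (d : nat -> nat) (X Y : forall n, T -> 'M[K]_(d n)) : Prop :=
  forall F G : set T,
    <<s entry_events X >> F -> <<s entry_events Y >> G ->
    P (F `&` G) = (P F * P G)%E.

Definition shifted_mx (R : realType) (n : nat) (M : 'M[R]_n) (z : R[i]) :
    'M[R[i]]_n :=
  map_mx (real_complex R) M - z%:M.

Definition resolvent (R : realType) (n : nat) (M : 'M[R]_n) (z : R[i]) :
    'M[R[i]]_n :=
  invmx (shifted_mx M z).

Definition stieltjes (R : realType) (n : nat) (M : 'M[R]_n) (z : R[i]) : R[i] :=
  n%:R^-1 * \tr (resolvent M z).

(* Main.v *)
(* Writing the scalars in real and imaginary parts turns every item into a
   statement about the real sequences D = Re (A - B) and D = Im (A - B): tr(E D)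
   tends to 0 almost surely for each standard E. Linearity of the trace gives
   the equivalence relation and the sum, and E = n^(-1) I gives the trace and
   the Stieltjes transforms. For a deterministic left factor A,
   tr(E (A D)) = tr((E A) D), and E A is standard because
   |E A|_tr <= |A|_op |E|_tr. For a random left factor independent of D, the
   deterministic case holds for almost every fixed value of A, and Fubini's
   theorem for the joint law of (A, D), which is a product, concludes. *)

Require Import Defs.
From HB Require Import structures.
From mathcomp Require Import all_boot all_order all_algebra.
From mathcomp Require Import complex.
From mathcomp Require Import all_classical all_reals all_analysis.
From mathcomp Require Import ring lra.
Import Order.TTheory GRing.Theory Num.Theory.
Import numFieldNormedType.Exports.

Set Implicit Arguments.
Unset Strict Implicit.
Unset Printing Implicit Defensive.

Local Open Scope classical_set_scope.
Local Open Scope ring_scope.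

(** * Square roots of positive matrices *)

(** Induction on [s]: the interpolant is corrected at a new point by a multiple of [q], which
    vanishes at all earlier points and not at the new one. *)
Lemma interpolation (F : fieldType) (s : seq F) (f : F -> F) :
  exists p : {poly F}, {in s, forall x, p.[x] = f x}.
Proof.
elim: s => [|x s [p ps]]; first by exists 0.
have [xs|xs] := boolP (x \in s).
  by exists p => y; rewrite inE => /predU1P[->|]; exact: ps.
pose q : {poly F} := \prod_(y <- s) ('X - y%:P).
have qx : q.[x] != 0 by apply: contraNneq xs => /eqP; rewrite -root_prod_XsubC.
exists (p + ((f x - p.[x]) / q.[x]) *: q) => y.
rewrite inE hornerD hornerZ => /predU1P[->|ys].
  by rewrite divfK// addrC subrK.
have /rootP -> : root q y by rewrite root_prod_XsubC.
by rewrite mulr0 addr0 ps.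
Qed.

Lemma tr_horner_mx (F : comNzRingType) (n : nat) (A : 'M[F]_n.+1) (p : {poly F}) :
  A^T = A -> (horner_mx A p)^T = horner_mx A p.
Proof.
move=> symA; elim/poly_ind: p => [|p c IHp]; first by rewrite rmorph0 trmx0.
rewrite rmorphD rmorphM /= horner_mx_X horner_mx_C linearD /= tr_scalar_mx.
rewrite trmx_mul IHp symA; congr (_ + _).
exact/esym/comm_horner_mx.
Qed.

(* Stated over an abstract closed field: unification is very slow at R[i]. *)
Lemma hermitian_spectrum (F : fieldType) (C : numClosedFieldType)
    (f : {rmorphism F -> C}) (n : nat) (N : 'M[F]_n.+1) :
  map_mx f N \is hermsymmx ->
  exists lam : 'rV[C]_n.+1,
    [/\ forall i, lam 0 i \is Num.real,
        forall i, eigenvalue (map_mx f N) (lam 0 i) &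
        forall q : {poly F},
          (forall i, (map_poly f q).[lam 0 i] = lam 0 i) -> horner_mx N q = N].
Proof.
move=> hermN; exists (spectral_diag (map_mx f N)).
have /orthomx_spectralP := hermitian_normalmx hermN.
have := hermitian_spectral_diag_real hermN.
have := spectral_unit (map_mx f N).
move: (spectralmx _) (spectral_diag _) => Q lam Qu /mxOverP lamR NE.
split=> [//|i|q qlam].
  (* Row i of [Q] is a left eigenvector; it is nonzero because [Q] is invertible. *)
  apply/eigenvalueP; exists (row i Q).
    rewrite -row_mul NE !mulmxA mulmxV// mul1mx row_mul row_diag_mx.
    by rewrite -scalemxAl -rowE.
  apply/eqP => rQ; have : delta_mx 0 i = 0 :> 'rV[C]_n.+1.
    by rewrite -[LHS](mulmxK Qu) -rowE rQ mul0mx.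
  move/matrixP/(_ 0 i)/eqP.
  by rewrite !mxE !eqxx oner_eq0.
apply: (@map_mx_inj _ _ f); rewrite map_horner_mx NE.
rewrite horner_mx_uconjC// horner_mx_diag; congr (_ *m diag_mx _ *m _).
by apply/rowP => i; rewrite mxE qlam.
Qed.

(** A left eigenvector v satisfies v N v^T = l (v v^T), where v v^T > 0. *)
Lemma psdmx_eigenvalue_ge0 (R : realType) (n : nat) (N : 'M[R]_n) (l : R) :
  psdmx N -> eigenvalue N l -> 0 <= l.
Proof.
move=> [symN posN] /eigenvalueP[v vN v0].
have := posN v^T; rewrite trmxK vN -scalemxAl mxE.
suff v_gt0 : 0 < (v *m v^T) 0 0 by rewrite pmulr_lge0.
rewrite mxE lt_neqAle eq_sym psumr_neq0/=; last first.
  by move=> i _; rewrite mxE -expr2 sqr_ge0.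
rewrite sumr_ge0 ?andbT; last by move=> i _; rewrite mxE -expr2 sqr_ge0.
apply/hasP; have /rV0Pn[i vi] := v0; exists i; first exact: mem_index_enum.
by rewrite /= mxE -expr2 lt_neqAle eq_sym sqrf_eq0 vi sqr_ge0.
Qed.

(* The complex spectral theorem makes a real polynomial taking the value l^(1/4)
   at every eigenvalue l of N satisfy r(N)^4 = N; then r(N)^2 is a real square
   root of N, and it is positive as the square of a symmetric matrix. *)
Lemma psdmx_sqrt (R : realType) (n : nat) (N : 'M[R]_n) :
  psdmx N -> exists2 S, psdmx S & S *m S = N.
Proof.
case: n N => [|n] N psdN.
  exists 0; last by rewrite mul0mx; exact/esym/flatmx0.
  by split=> [|x]; rewrite ?trmx0// mulmx0 mul0mx mxE.
pose toC := real_complex R; pose Nc := map_mx toC N.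
have hermN : Nc \is hermsymmx.
  apply: realsym_hermsym.
    apply/is_hermitianmxP; rewrite expr0 scale1r map_mx_id//.
    by rewrite /Nc map_trmx (proj1 psdN).
  by apply/mxOverP => i j; rewrite mxE complex_real.
have [lam [lamR eigN hornerN]] := hermitian_spectrum hermN.
pose l i := complex.Re (lam 0 i).
have lamE i : lam 0 i = toC (l i) by rewrite /toC RRe_real.
have l_ge0 i : 0 <= l i.
  (* The real number [l i] is a root of the characteristic polynomial over R[i], hence over R. *)
  apply: (psdmx_eigenvalue_ge0 psdN).
  have := eigN i.
  by rewrite lamE !eigenvalue_root_char -map_char_poly fmorph_root.
have [r rE] := interpolation [seq l i | i <- enum 'I_n.+1]
  (fun x => Num.sqrt (Num.sqrt x)).
pose S := horner_mx N r.
have symS : S^T = S by apply: tr_horner_mx; case: psdN.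
have S4 : S *m S *m (S *m S) = N.
  have -> : S *m S *m (S *m S) = horner_mx N (r * r * (r * r)).
    by rewrite !rmorphM.
  apply: hornerN => i; rewrite lamE horner_map/= !hornerM rE; last first.
    by apply: map_f; rewrite mem_enum.
  by rewrite -!expr2 !sqr_sqrtr ?sqrtr_ge0.
exists (S *m S) => //; split=> [|x]; first by rewrite trmx_mul symS.
have -> : x^T *m (S *m S) *m x = (S *m x)^T *m (S *m x).
  by rewrite trmx_mul symS !mulmxA.
by rewrite mxE sumr_ge0// => i _; rewrite mxE -expr2 sqr_ge0.
Qed.

(** * The trace norm of a product *)

Definition dotv (R : realType) (n : nat) (x y : 'cV[R]_n) : R :=
  \sum_i x i 0 * y i 0.

Lemma dotvE (R : realType) (n : nat) (x y : 'cV[R]_n) :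
  dotv x y = (x^T *m y) 0 0.
Proof. by rewrite mxE; apply: eq_bigr => i _; rewrite mxE. Qed.

Lemma dotv_ge0 (R : realType) (n : nat) (x : 'cV[R]_n) : 0 <= dotv x x.
Proof. by apply: sumr_ge0 => i _; rewrite -expr2 sqr_ge0. Qed.

Lemma dotv_eq0 (R : realType) (n : nat) (x : 'cV[R]_n) :
  dotv x x = 0 -> x = 0.
Proof.
move=> /eqP; rewrite psumr_eq0 => [/allP x0|i _]; last by rewrite -expr2 sqr_ge0.
apply/colP => i; rewrite mxE; have := x0 i (mem_index_enum i).
by rewrite /= mulf_eq0 orbb => /eqP.
Qed.

(** With [dotv_ge0] and well-chosen coefficients, this takes the place of the Cauchy-Schwarz
    inequality in [opbound_tr] and [trace_psd_le]. *)
Lemma dotv_sub (R : realType) (n : nat) (a b : R) (x y : 'cV[R]_n) :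
  dotv (a *: x - b *: y) (a *: x - b *: y) =
  a ^+ 2 * dotv x x - 2 * (a * b) * dotv x y + b ^+ 2 * dotv y y.
Proof.
rewrite /dotv !mulr_sumr -sumrB -big_split /=; apply: eq_bigr => i _.
by rewrite !mxE; ring.
Qed.

Lemma dotv_mull (R : realType) (n : nat) (M : 'M[R]_n) (x y : 'cV[R]_n) :
  dotv (M *m x) y = dotv x (M^T *m y).
Proof. by rewrite !dotvE trmx_mul mulmxA. Qed.

(** For c >= 0 this says |M|_op <= c, without a supremum and in a form suited to polynomial
    arithmetic. *)
Definition opbound (R : realType) (n : nat) (c : R) (M : 'M[R]_n) : Prop :=
  forall x : 'cV[R]_n, dotv (M *m x) (M *m x) <= c ^+ 2 * dotv x x.

Lemma opboundM (R : realType) (n : nat) (a b : R) (A B : 'M[R]_n) :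
  opbound a A -> opbound b B -> opbound (a * b) (A *m B).
Proof.
move=> hA hB x; rewrite -mulmxA exprMn -mulrA.
by apply: (le_trans (hA _)); rewrite ler_wpM2l ?sqr_ge0.
Qed.

(** With u = M^T y, <y, M u> = |u|^2. Expanding |c^2 y - M u|^2 >= 0 and using |M u|^2 <= c^2 |u|^2
    gives c^2 |u|^2 <= c^4 |y|^2. *)
Lemma opbound_tr (R : realType) (n : nat) (c : R) (M : 'M[R]_n) :
  0 < c -> opbound c M -> opbound c M^T.
Proof.
move=> c0 hM y.
have := dotv_ge0 ((c ^+ 2) *: y - 1 *: (M *m (M^T *m y))).
rewrite dotv_sub expr1n mul1r mulr1.
have -> : dotv y (M *m (M^T *m y)) = dotv (M^T *m y) (M^T *m y).
  by rewrite dotv_mull trmxK.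
have := hM (M^T *m y).
set a := dotv (M^T *m y) _; set b := dotv (M *m _) _; set d := dotv y y.
move=> ba h; rewrite -(ler_pM2l (exprn_gt0 2 c0)); nra.
Qed.

(** Writing S = Q Q with Q symmetric, tr(Y S) = tr(Q Y Q) is the sum of <q, Y q> over the columns q
    of Q, and |c q - Y q|^2 >= 0 yields <q, Y q> <= c |q|^2. *)
Lemma trace_psd_le (R : realType) (n : nat) (c : R) (Y S : 'M[R]_n) :
  0 < c -> opbound c Y -> psdmx S -> \tr (Y *m S) <= c * \tr S.
Proof.
move=> c0 hY /psdmx_sqrt[Q [symQ _] <-].
have trE (Z : 'M[R]_n) : \tr (Q *m Z) = \sum_i dotv (col i Q) (col i Z).
  apply: eq_bigr => i _; rewrite -{1}symQ mxE.
  by apply: eq_bigr => k _; rewrite !mxE.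
rewrite mulmxA mxtrace_mulC !trE mulr_sumr; apply: ler_sum => i _.
rewrite (_ : col i (Y *m Q) = Y *m col i Q); last by rewrite !colE mulmxA.
set q := col i Q.
have := dotv_ge0 (c *: q - 1 *: (Y *m q)); rewrite dotv_sub expr1n mul1r mulr1.
move: (hY q); set a := dotv q q; set b := dotv q _; set d := dotv _ _ => h1 h2.
by rewrite -(ler_pM2l c0); nra.
Qed.

Lemma psdmx1 (R : realType) (n : nat) : psdmx (1%:M : 'M[R]_n).
Proof. by split=> [|x]; rewrite ?trmx1// mulmx1 -dotvE dotv_ge0. Qed.

(** A row v in the kernel gives v S v^T + e |v|^2 = 0 with both terms nonnegative, so v = 0. *)
Lemma unitmx_psd_shift (R : realType) (n : nat) (S : 'M[R]_n) (e : R) :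
  0 < e -> psdmx S -> S + e%:M \in unitmx.
Proof.
move=> e0 [symS posS]; rewrite unitmxE unitfE; apply/det0P => -[v v0 vS].
have := congr1 (fun w : 'rV_n => (w *m v^T) 0 0) vS.
rewrite /= mulmxDr mulmxDl mul0mx [RHS]mxE [LHS]mxE mul_mx_scalar -scalemxAl.
rewrite [X in _ + X]mxE -{3}[v]trmxK -dotvE => vSv.
have := posS v^T; rewrite trmxK => vSv_ge0.
have v_ge0 := dotv_ge0 v^T.
have vv0 : dotv v^T v^T = 0 by nra.
by have := dotv_eq0 vv0 => /eqP; rewrite trmx_eq0; apply/negP.
Qed.

(* Replacing S by S + e, which is invertible, avoids the polar decomposition of
   a singular E. *)
Lemma opbound_polar (R : realType) (n : nat) (E S : 'M[R]_n) (e : R) :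
  0 < e -> psdmx S -> S *m S = E^T *m E ->
  opbound 1 (E *m invmx (S + e%:M)).
Proof.
move=> e0 psdS SE x; have [symS posS] := psdS.
suff h (y : 'cV[R]_n) :
    dotv (E *m y) (E *m y) <= 1 ^+ 2 * dotv ((S + e%:M) *m y) ((S + e%:M) *m y).
  have := h (invmx (S + e%:M) *m x).
  by rewrite mulKVmx ?unitmx_psd_shift// mulmxA.
(* |E y| = |S y|, and |(S + e) y|^2 exceeds |S y|^2 by 2 e <S y, y> + e^2 |y|^2. *)
have -> : dotv (E *m y) (E *m y) = dotv (S *m y) (S *m y).
  by rewrite !dotv_mull symS !mulmxA SE.
have -> : (S + e%:M) *m y = 1 *: (S *m y) - (- e) *: y.
  by rewrite scale1r scaleNr opprK mulmxDl mul_scalar_mx.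
rewrite dotv_sub !expr1n !mul1r sqrrN.
have : 0 <= dotv (S *m y) y by rewrite dotv_mull symS dotvE mulmxA.
have := dotv_ge0 y; nra.
Qed.

(** E = V (S + d) for the contraction V = E (S + d)^-1, so tr(X E) = tr(X V S) + d tr(X V) <= c tr S
    + d c n, and d is arbitrarily small. *)
Lemma trace_polar_le (R : realType) (n : nat) (c : R) (X E S : 'M[R]_n) :
  0 < c -> opbound c X -> psdmx S -> S *m S = E^T *m E ->
  \tr (X *m E) <= c * \tr S.
Proof.
move=> c0 hX psdS SE; apply/ler_addgt0Pr => e e0.
(* This d makes the error d c n at most e; [n.+1] keeps the quotient meaningful when n = 0. *)
have d0 : 0 < e / (c * n.+1%:R) by rewrite divr_gt0// mulr_gt0.
set d := e / _ in d0; pose V := E *m invmx (S + d%:M).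
have hXV : opbound c (X *m V).
  by rewrite -[c]mulr1; apply: opboundM => //; exact: opbound_polar.
have -> : X *m E = X *m V *m S + d *: (X *m V *m 1%:M).
  rewrite mulmx1 -mul_mx_scalar -mulmxDr -[in RHS]mulmxA mulmxKV//.
  exact: unitmx_psd_shift.
rewrite mxtraceD mxtraceZ lerD ?trace_psd_le//.
have := trace_psd_le c0 hXV (psdmx1 R n); rewrite mxtrace1 => h.
apply: (@le_trans _ _ (d * (c * n%:R))); first by rewrite ler_pM2l.
rewrite /d -[leRHS](@divfK _ (c * n.+1%:R)) ?mulf_neq0 ?gt_eqF//.
by rewrite ler_pM2l// ler_pM2l// ler_nat.
Qed.

(** For the contraction W = E A (S2 + d)^-1, tr(W^T E A) = tr(S2 (S2 + d)^-1 S2), which is within d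
    n of tr S2. By cyclicity it is also tr((A W^T) E), at most c tr S1 by [trace_polar_le]. *)
Lemma trace_root_mul_le (R : realType) (n : nat) (c : R) (E A S1 S2 : 'M[R]_n) :
  0 < c -> opbound c A ->
  psdmx S1 -> S1 *m S1 = E^T *m E ->
  psdmx S2 -> S2 *m S2 = (E *m A)^T *m (E *m A) ->
  \tr S2 <= c * \tr S1.
Proof.
move=> c0 hA psd1 S1E psd2 S2E; apply/ler_addgt0Pr => e e0.
have d0 : 0 < e / n.+1%:R by rewrite divr_gt0.
set d := e / _ in d0; have uT := unitmx_psd_shift d0 psd2.
set W := E *m A *m invmx (S2 + d%:M).
have symT : (S2 + d%:M)^T = S2 + d%:M.
  by rewrite linearD /= tr_scalar_mx (proj1 psd2).
have hW : opbound 1 W^T by apply: opbound_tr => //; exact: opbound_polar.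
have hAW : opbound c (A *m W^T) by rewrite -[c]mulr1; exact: opboundM.
(* Here [opbound_polar] is applied with [S2] in both roles, as [S2] is symmetric. *)
have hS : opbound 1 (S2 *m invmx (S2 + d%:M)).
  by apply: opbound_polar => //; rewrite (proj1 psd2).
have := trace_polar_le c0 hAW psd1 S1E.
rewrite -mulmxA mxtrace_mulC -mulmxA trmx_mul trmx_inv symT.
rewrite -mulmxA -S2E mulmxA mxtrace_mulC => h1.
have := trace_psd_le ltr01 hS (psdmx1 R n); rewrite mulmx1 mxtrace1 mul1r => h2.
have S2e : S2 = S2 *m (invmx (S2 + d%:M) *m S2) + d *: (S2 *m invmx (S2 + d%:M)).
  rewrite scalemxAr -mulmxDr -mul_mx_scalar -mulmxDr mulVmx// mulmx1//.
rewrite S2e mxtraceD mxtraceZ lerD//.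
apply: (@le_trans _ _ (d * n%:R)); first by rewrite ler_pM2l.
rewrite /d -[leRHS](@divfK _ n.+1%:R)//.
by rewrite ler_pM2l// ler_nat.
Qed.

Lemma psdmx_gram (R : realType) (n : nat) (M : 'M[R]_n) : psdmx (M^T *m M).
Proof.
split=> [|x]; first by rewrite trmx_mul trmxK.
by rewrite -!mulmxA mulmxA -trmx_mul -dotvE dotv_ge0.
Qed.

Lemma sqrtmxP (R : realType) (n : nat) (N : 'M[R]_n) :
  psdmx N -> psdmx (sqrtmx N) /\ sqrtmx N *m sqrtmx N = N.
Proof.
move=> /psdmx_sqrt[S psdS SN].
by apply: (@xgetPex _ 0 [set S | psdmx S /\ S *m S = N]); exists S.
Qed.

Lemma trace_norm_mulr_le (R : realType) (n : nat) (c : R) (E A : 'M[R]_n) :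
  0 < c -> opbound c A -> trace_norm (E *m A) <= c * trace_norm E.
Proof.
move=> c0 hA; have [psd1 S1E] := sqrtmxP (psdmx_gram E).
have [psd2 S2E] := sqrtmxP (psdmx_gram (E *m A)).
exact: (trace_root_mul_le c0 hA psd1 S1E psd2 S2E).
Qed.

(** For n > 0 let a = 1/n. Since S^2 = a^2 I, expanding tr((S - a)^2) >= 0 gives 2 a - 2 a tr S >=
    0. For n = 0 the trace is an empty sum. *)
Lemma trace_norm_scalar_le1 (R : realType) (n : nat) :
  trace_norm (n%:R^-1%:M : 'M[R]_n) <= 1.
Proof.
have [[symS _]] := sqrtmxP (psdmx_gram (n%:R^-1%:M : 'M[R]_n)).
rewrite /trace_norm; move: (sqrtmx _) symS => S symS SS.
case: n S symS SS => [|n] S symS SS; first by rewrite /mxtrace big_ord0.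
set a : R := n.+1%:R^-1 in SS *.
have a0 : 0 < a by rewrite invr_gt0.
have aK : a * n.+1%:R = 1 by rewrite mulVf.
have : 0 <= \tr ((S - a%:M)^T *m (S - a%:M)).
  apply: sumr_ge0 => i _; rewrite mxE; apply: sumr_ge0 => j _.
  by rewrite !mxE -expr2 sqr_ge0.
rewrite (_ : (S - a%:M)^T = S - a%:M); last first.
  by rewrite linearB /= symS tr_scalar_mx.
rewrite mulmxBl !mulmxBr SS tr_scalar_mx.
rewrite -!scalar_mxM !mul_scalar_mx mul_mx_scalar !linearB /= !linearZ /= !mxtrace_scalar.
rewrite -mulr_natr -mulrA aK /GRing.scale /= => h.
by rewrite -(ler_pM2l a0); lra.
Qed.

(** * Independence and almost sure convergence *)

Lemma bounded_seqP (R : realType) (u : nat -> R) :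
  bounded_seq u <-> exists M, \forall n \near \oo, u n <= M.
Proof.
split=> [/ereal_inf_lt[y [V Voo <-]] supV|[M uM]].
  have le_sup n : V n -> ((u n)%:E <= ereal_sup [set (u n)%:E | n in V])%E.
    by move=> Vn; apply: ereal_sup_ubound; exists n.
  move: supV le_sup; case: (ereal_sup _) => [r|//|] _ le_sup.
    by exists r; apply: filterS Voo => n /le_sup.
  (* A supremum equal to -oo leaves no index in [V], so the value 0 is arbitrary. *)
  by exists 0; apply: filterS Voo => n /le_sup; rewrite leeNy_eq.
apply: (@le_lt_trans _ _ M%:E); last by rewrite ltry.
pose V := [set n | u n <= M].
apply: (@le_trans _ _ (ereal_sup [set (u n)%:E | n in V])).
  by apply: ereal_inf_lbound; exists V.
by apply: ge_ereal_sup => _ [n Vn <-]; rewrite lee_fin.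
Qed.

(* Independence makes the law of w |-> (w, w) on the product of the two
   sigma-algebras the product of the restrictions of P. The exceptional set of
   the hypothesis need not be measurable for the first sigma-algebra, but the
   set of w1 whose section has probability 1 is. *)
Lemma ae_diagonal (R : realType) (disp : measure_display)
    (T : measurableType disp) (P : probability T R) (G1 G2 : set (set T))
    (S : set (g_sigma_algebraType G1 * g_sigma_algebraType G2)) :
  G1 `<=` measurable -> G2 `<=` measurable ->
  (forall A B : set T, <<s G1 >> A -> <<s G2 >> B ->
     P (A `&` B) = (P A * P B)%E) ->
  measurable S ->
  {ae P, forall w1, {ae P, forall w2, S (w1, w2)}} ->
  {ae P, forall w, S (w, w)}.
Proof.
move=> mG1 mG2 indep mS aeS.
pose T1 := g_sigma_algebraType G1; pose T2 := g_sigma_algebraType G2.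
have sub1 : <<s G1 >> `<=` measurable.
  by apply: smallest_sub => //; exact: sigma_algebra_measurable.
have sub2 : <<s G2 >> `<=` measurable.
  by apply: smallest_sub => //; exact: sigma_algebra_measurable.
have m1 : measurable_fun [set: T] (idfun : T -> T1).
  by move=> _ A mA; rewrite setTI; exact: sub1.
have m2 : measurable_fun [set: T] (idfun : T -> T2).
  by move=> _ A mA; rewrite setTI; exact: sub2.
have m12 : measurable_fun [set: T] (fun w => (w, w) : T1 * T2).
  exact: measurable_fun_pair.
pose X1 : {mfun T >-> T1} := mfun_Sub (mem_set m1).
pose X2 : {mfun T >-> T2} := mfun_Sub (mem_set m2).
pose X12 : {mfun T >-> (T1 * T2)%type} := mfun_Sub (mem_set m12).
pose mu1 := distribution P X1; pose mu2 := distribution P X2.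
(* On a rectangle A x B the law of (w, w) gives P(A [&] B), so independence is the hypothesis of
   uniqueness. *)
have prodE := @product_measure_unique _ _ T1 T2 R mu1 mu2 (distribution P X12).
have PS : P [set w : T | S (w, w)] = (mu1 \x mu2)%E S.
  by rewrite prodE// => A B mA mB; exact: indep.
have mf := @measurable_fun_xsection _ _ T1 T2 R mu2 S mS.
have f1 : ae_eq mu1 setT (mu2 \o xsection S) (cst 1%E).
  have m1f : measurable [set w : T1 | (mu2 \o xsection S) w = 1%E].
    by rewrite -[X in measurable X]setTI; exact: (measurable_eqe _ mf).
  exists (~` [set w : T1 | (mu2 \o xsection S) w = 1%E]); split.
  - exact: measurableC.
  - have : P.-negligible (~` [set w : T | (mu2 \o xsection S) w = 1%E]).
      case: aeS => N [mN N0 subN]; exists N; split => //.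
      apply: subset_trans subN; apply: subsetC => w1 /= aeS.
      have mSw : (measurable : set (set T)) (xsection S w1).
        exact: sub2 (@measurable_xsection _ _ T1 T2 S w1 mS).
      have : P (~` (xsection S w1)) = 0%E.
        apply/negligibleP; first exact: measurableC.
        by apply: negligibleS aeS; apply: subsetC => w2 Sw;
          rewrite /xsection /= mem_set.
      rewrite probability_setC// => /eqP; rewrite sube_eq ?fin_num_measure//.
      by rewrite add0e => /eqP/esym.
    have mC := sub1 _ (@measurableC _ T1 _ m1f).
    by move/(negligibleP _ mC).
  - by move=> w; apply: contra_not => h _.
have PS1 : P [set w : T | S (w, w)] = 1%E.
  rewrite PS /product_measure1 (ge0_ae_eq_integral _ _ _ _ _ f1)//.
  by rewrite integral_cst// mul1e; exact: (probability_setT P).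
have mSd : measurable [set w : T | S (w, w)].
  by have := m12 measurableT _ mS; rewrite setTI.
exists (~` [set w : T | S (w, w)]); split=> //; first exact: measurableC.
by rewrite probability_setC// PS1 subee.
Qed.

(** Testing convergence against the radii 1/(k+1) only makes the set a countable combination of
    measurable sets. *)
Lemma measurable_cvg0 (R : realType) (disp : measure_display)
    (T : measurableType disp) (u : nat -> T -> R) :
  (forall n, measurable_fun setT (u n)) ->
  measurable [set w | u n w @[n --> \oo] --> 0].
Proof.
move=> mu.
have -> : [set w | u n w @[n --> \oo] --> 0] =
    \bigcap_k \bigcup_N \bigcap_(n in [set n | (N <= n)%N])
      [set w | `|u n w| < k.+1%:R^-1].
  apply/seteqP; split=> w /=.
    move=> /cvgr0Pnorm_lt uw k _; have [//|N _ hN] := uw k.+1%:R^-1.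
    by exists N.
  move=> uw; apply/cvgr0Pnorm_lt => e e0.
  have [k ke] := ltr_add_invr e0; rewrite add0r in ke.
  have [N _ hN] := uw k I; exists N => // n /= Nn.
  exact: lt_trans (hN n Nn) ke.
apply: bigcapT_measurable => k; apply: bigcupT_measurable => N.
apply: bigcap_measurableType => n _.
have mn : measurable_fun setT (fun w => `|u n w|) by exact: measurableT_comp.
have := mn measurableT _ (measurable_itv `]-oo, k.+1%:R^-1[).
by rewrite setTI; congr measurable.
Qed.

(** [entry_events] provides preimages of open sets; open rays suffice to generate the Borel sets. *)
Lemma measurable_fun_open (R : realType) (disp : measure_display)
    (T : measurableType disp) (f : T -> R) :
  (forall U, open U -> measurable (f @^-1` U)) -> measurable_fun setT f.
Proof.
move=> mf; apply: (measurability _ (measurable_realfun.RGenOInfty.measurableE R)).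
move=> _ [_ [a ->] <-]; rewrite setTI.
by apply: mf; exact: interval_open.
Qed.

(** * Real and imaginary parts *)

(* Treats K = R, where im = 0, and K = R[i] uniformly. *)
Record scalar_parts (R : realType) (K : numFieldType) (iota : R -> K) :=
  ScalarParts {
  re : K -> R;
  im : K -> R;
  re_add : {morph re : x y / x + y};
  im_add : {morph im : x y / x + y};
  re_mul : forall x y, re (x * y) = re x * re y - im x * im y;
  im_mul : forall x y, im (x * y) = re x * im y + im x * re y;
  re_iota : forall a, re (iota a) = a;
  im_iota : forall a, im (iota a) = 0;
  norm_parts : forall x, `|x| = iota (Num.sqrt (re x ^+ 2 + im x ^+ 2)) }.

(** Splits once into the real and complex cases, so that everything below is proved for a single
    abstract morphism with parts. *)
Lemma scalar_embedding_parts (R : realType) (K : numFieldType) (iota : R -> K) :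
  scalar_embedding iota ->
  exists f : {rmorphism R -> K},
    [/\ iota = f, {mono f : x y / x <= y} & inhabited (scalar_parts f)].
Proof.
case.
  exists idfun; split=> //; constructor.
  exists idfun (fun=> 0) => //= [x y|x y|x y|x]; rewrite ?addr0 ?mul0r ?subr0//.
    by rewrite mulr0 addr0.
  by rewrite expr0n /= addr0 sqrtr_sqr.
exists (real_complex R); split=> //; first exact: lecR.
constructor; exists (@complex.Re R) (@complex.Im R) => //=.
- by move=> [a b] [c d].
- by move=> [a b] [c d].
- by move=> [a b] [c d].
- by move=> [a b] [c d].
- exact: normc_def.
Qed.

Section ScalarParts.
Context (R : realType) (K : numFieldType) (iota : {rmorphism R -> K}).
Hypothesis le_iota : {mono iota : x y / x <= y}.
Variable s : scalar_parts iota.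

Let lt_iota : {mono iota : x y / x < y} := leW_mono le_iota.

Lemma re0 : re s 0 = 0.
Proof. by rewrite -(rmorph0 iota) re_iota. Qed.

Lemma im0 : im s 0 = 0.
Proof. by rewrite -(rmorph0 iota) im_iota. Qed.

Lemma re_opp (x : K) : re s (- x) = - re s x.
Proof. by apply/eqP; rewrite -addr_eq0 -re_add addNr re0. Qed.

Lemma im_opp (x : K) : im s (- x) = - im s x.
Proof. by apply/eqP; rewrite -addr_eq0 -im_add addNr im0. Qed.

Lemma re_mulmx (m n p : nat) (A : 'M[K]_(m, n)) (B : 'M[K]_(n, p)) :
  map_mx (re s) (A *m B) =
  map_mx (re s) A *m map_mx (re s) B - map_mx (im s) A *m map_mx (im s) B.
Proof.
apply/matrixP => i j; rewrite !mxE (big_morph _ (re_add s) re0) -sumrB.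
by apply: eq_bigr => k _; rewrite re_mul !mxE.
Qed.

Lemma im_mulmx (m n p : nat) (A : 'M[K]_(m, n)) (B : 'M[K]_(n, p)) :
  map_mx (im s) (A *m B) =
  map_mx (re s) A *m map_mx (im s) B + map_mx (im s) A *m map_mx (re s) B.
Proof.
apply/matrixP => i j; rewrite !mxE (big_morph _ (im_add s) im0) -big_split.
by apply: eq_bigr => k _; rewrite im_mul !mxE.
Qed.

Lemma re_subr_mx (m n : nat) (A B : 'M[K]_(m, n)) :
  map_mx (re s) (A - B) = map_mx (re s) A - map_mx (re s) B.
Proof. by apply/matrixP => i j; rewrite !mxE re_add re_opp. Qed.

Lemma im_subr_mx (m n : nat) (A B : 'M[K]_(m, n)) :
  map_mx (im s) (A - B) = map_mx (im s) A - map_mx (im s) B.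
Proof. by apply/matrixP => i j; rewrite !mxE im_add im_opp. Qed.

Lemma re_iota_mx (m n : nat) (A : 'M[R]_(m, n)) : map_mx (re s) (map_mx iota A) = A.
Proof. by apply/matrixP => i j; rewrite !mxE re_iota. Qed.

Lemma im_iota_mx (m n : nat) (A : 'M[R]_(m, n)) : map_mx (im s) (map_mx iota A) = 0.
Proof. by apply/matrixP => i j; rewrite !mxE im_iota. Qed.

Lemma re_trace (n : nat) (E : 'M[R]_n) (D : 'M[K]_n) :
  re s (\tr (map_mx iota E *m D)) = \tr (E *m map_mx (re s) D).
Proof.
have := re_mulmx (map_mx iota E) D; rewrite re_iota_mx im_iota_mx mul0mx subr0 => <-.
by rewrite /mxtrace (big_morph _ (re_add s) re0); apply: eq_bigr => i _; rewrite [RHS]mxE.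
Qed.

Lemma im_trace (n : nat) (E : 'M[R]_n) (D : 'M[K]_n) :
  im s (\tr (map_mx iota E *m D)) = \tr (E *m map_mx (im s) D).
Proof.
have := im_mulmx (map_mx iota E) D; rewrite re_iota_mx im_iota_mx mul0mx addr0 => <-.
by rewrite /mxtrace (big_morph _ (im_add s) im0); apply: eq_bigr => i _; rewrite [RHS]mxE.
Qed.

Lemma norm_lt_parts (x : K) (e : R) :
  `|x| < iota e -> `|re s x| < e /\ `|im s x| < e.
Proof.
rewrite (norm_parts s) lt_iota => h.
by split; apply: le_lt_trans h; rewrite -sqrtr_sqr ler_wsqrtr// (lerDl, lerDr) sqr_ge0.
Qed.

Lemma parts_lt_norm (x : K) (e : R) :
  `|re s x| < e -> `|im s x| < e -> `|x| < iota (e + e).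
Proof.
move=> re_lt im_lt; rewrite (norm_parts s) lt_iota.
apply: le_lt_trans (ltrD re_lt im_lt).
rewrite -[leRHS]ger0_norm ?addr_ge0// -[leRHS]sqrtr_sqr ler_wsqrtr//.
rewrite sqrrD !real_normK ?num_real// -addrA [X in _ <= _ + X]addrC addrA.
by rewrite lerDl mulrn_wge0// mulr_ge0.
Qed.

(** A positive element equals its own norm, and norms lie in the image of [iota]; hence every radius
    in [K] comes from a real one. *)
Lemma gt0_iota (x : K) : 0 < x -> exists2 e : R, 0 < e & x = iota e.
Proof.
move=> x0; exists (Num.sqrt (re s x ^+ 2 + im s x ^+ 2)); last first.
  by rewrite -norm_parts gtr0_norm.
by rewrite -lt_iota rmorph0 -norm_parts normr_gt0 gt_eqF.
Qed.

Lemma cvg0_parts (X : nat -> K) :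
  `|X n| @[n --> \oo] --> (0 : K) <->
  re s (X n) @[n --> \oo] --> 0 /\ im s (X n) @[n --> \oo] --> 0.
Proof.
split=> [/cvgr0Pnorm_lt X0|[/cvgr0Pnorm_lt re0 /cvgr0Pnorm_lt im0]].
  by split; apply/cvgr0Pnorm_lt => e e0;
    (have : 0 < iota e by rewrite -(rmorph0 iota) lt_iota);
    move=> /X0; apply: filterS => n; rewrite normr_id => /norm_lt_parts[].
apply/cvgr0Pnorm_lt => _ /gt0_iota[e e0 ->].
have e20 : 0 < e / 2 by rewrite divr_gt0.
apply: filterS2 (re0 _ e20) (im0 _ e20) => n; rewrite normr_id {3}(splitr e).
exact: parts_lt_norm.
Qed.

Lemma continuous_re : continuous (re s).
Proof.
move=> x; apply/(@cvgrPdist_lt _ _ _ (nbhs x) (nbhs_filter x)) => e e0.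
apply/nbhs_normP; exists (iota e) => [|y /=]; first by rewrite /= -(rmorph0 iota) lt_iota.
by rewrite /ball_ /= => /norm_lt_parts[+ _]; rewrite re_add re_opp.
Qed.

Lemma continuous_im : continuous (im s).
Proof.
move=> x; apply/(@cvgrPdist_lt _ _ _ (nbhs x) (nbhs_filter x)) => e e0.
apply/nbhs_normP; exists (iota e) => [|y /=]; first by rewrite /= -(rmorph0 iota) lt_iota.
by rewrite /ball_ /= => /norm_lt_parts[_ +]; rewrite im_add im_opp.
Qed.

Lemma sqnorm_parts (n : nat) (x : 'cV[K]_n) :
  sqnorm x = iota (dotv (map_mx (re s) x) (map_mx (re s) x) +
                   dotv (map_mx (im s) x) (map_mx (im s) x)).
Proof.
rewrite /sqnorm /dotv -big_split rmorph_sum; apply: eq_bigr => i _ /=.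
rewrite (norm_parts s) -rmorphXn /= sqr_sqrtr ?addr_ge0 ?sqr_ge0//.
by rewrite !mxE !expr2.
Qed.

(** The content is that the set in [op_norm] is bounded above, without which [sup] would carry no
    information. *)
Lemma le_op_norm (n : nat) (M : 'M[K]_n) (x : 'cV[K]_n) (r : R) :
  0 <= r -> sqnorm x = 1 -> sqnorm (M *m x) = iota (r ^+ 2) ->
  r <= op_norm iota M.
Proof.
move=> r0 x1 Mx; apply: ub_le_sup; last by split=> //; exists x.
(* Entries of a unit vector have norm at most 1, so [b] bounds |M y|^2. *)
pose b := \sum_i (\sum_j `|M i j|) ^+ 2.
have b0 : 0 <= b by apply: sumr_ge0 => i _; rewrite exprn_ge0// sumr_ge0.
have le_entry (y : 'cV[K]_n) j : sqnorm y = 1 -> `|y j 0| <= 1.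
  move=> y1; rewrite -(@expr_le1 _ 2)// -y1 /sqnorm (bigD1 j)//= lerDl.
  by apply: sumr_ge0 => k _; rewrite exprn_ge0.
(* The square root is |b| read in R, called [e] below; t^2 <= e implies t <= 1 + e. *)
exists (1 + Num.sqrt (re s b ^+ 2 + im s b ^+ 2)) => t [t0 [y y1 My]].
set e := Num.sqrt _; have e0 : 0 <= e by exact: sqrtr_ge0.
have te : t ^+ 2 <= e.
  rewrite -le_iota -My -norm_parts ger0_norm//; apply: ler_sum => i _.
  rewrite lerXn2r ?nnegrE ?sumr_ge0// mxE; apply: le_trans (ler_norm_sum _ _ _) _.
  by apply: ler_sum => j _; rewrite normrM ler_piMr// le_entry.
nra.
Qed.

(** On a real vector x, |M x|^2 = |Re(M) x|^2 + |Im(M) x|^2, so a bound for M bounds both parts. *)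
Lemma op_norm_opbound (n : nat) (M : 'M[K]_n) (c : R) :
  op_norm iota M <= c -> 0 <= c ->
  opbound c (map_mx (re s) M) /\ opbound c (map_mx (im s) M).
Proof.
move=> Mc c0.
suff h (x : 'cV[R]_n) : dotv (map_mx (re s) M *m x) (map_mx (re s) M *m x) +
    dotv (map_mx (im s) M *m x) (map_mx (im s) M *m x) <= c ^+ 2 * dotv x x.
  by split=> x; apply: le_trans (h x); rewrite (lerDl, lerDr) dotv_ge0.
have [->|x0] := eqVneq x 0.
  rewrite !mulmx0 (_ : dotv 0 0 = 0) ?mulr0 ?addr0//.
  by rewrite /dotv big1// => i _; rewrite mxE mul0r.
have d0 : 0 < dotv x x.
  by rewrite lt_neqAle dotv_ge0 andbT eq_sym; apply: contra_neq x0 => /dotv_eq0.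
(* Normalizes x, since [op_norm] only sees unit vectors. *)
pose a := (Num.sqrt (dotv x x))^-1.
have a2 : a ^+ 2 * dotv x x = 1.
  by rewrite exprVn sqr_sqrtr ?dotv_ge0// mulVf// gt_eqF.
have dotvZ (y : 'cV[R]_n) : dotv (a *: y) (a *: y) = a ^+ 2 * dotv y y.
  have := dotv_sub a 0 y 0; rewrite scale0r subr0 => ->; ring.
set d := _ + _; have dge0 : 0 <= a ^+ 2 * d by rewrite mulr_ge0 ?sqr_ge0 ?addr_ge0 ?dotv_ge0.
have : Num.sqrt (a ^+ 2 * d) <= c.
  apply: le_trans Mc; apply: (@le_op_norm _ _ (map_mx iota (a *: x))).
  - exact: sqrtr_ge0.
  - rewrite sqnorm_parts re_iota_mx im_iota_mx dotvZ a2.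
    by rewrite (_ : dotv 0 0 = 0) ?addr0 ?rmorph1// /dotv big1// => i _; rewrite mxE mul0r.
  - rewrite sqnorm_parts re_mulmx im_mulmx re_iota_mx im_iota_mx !mulmx0 subr0 add0r.
    by rewrite -!scalemxAr !dotvZ -mulrDr sqr_sqrtr.
rewrite -(@ler_pXn2r _ 2) ?nnegrE ?sqrtr_ge0// sqr_sqrtr// => h.
by rewrite -[d]mul1r -a2 mulrAC ler_wpM2r ?dotv_ge0.
Qed.

End ScalarParts.

(** * Deterministic equivalence *)

(* The real form of [det_equiv]: D is the difference of the two sequences. *)
Definition vanishing (R : realType) (disp : measure_display)
    (T : measurableType disp) (P : probability T R) (d : nat -> nat)
    (D : forall n, T -> 'M[R]_(d n)) : Prop :=
  forall E : (forall n, 'M[R]_(d n)), standard E ->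
    {ae P, forall w, \tr (E n *m D n w) @[n --> \oo] --> 0}.

Section Vanishing.
Context (R : realType) (disp : measure_display) (T : measurableType disp).
Context (P : probability T R) (d : nat -> nat).
Implicit Types D : forall n, T -> 'M[R]_(d n).

Lemma vanishing_ext D1 D2 :
  vanishing P D1 -> (forall n w, D1 n w = D2 n w) -> vanishing P D2.
Proof.
move=> D10 eqD E /D10; apply: filterS => w.
by under eq_fun do rewrite eqD.
Qed.

Lemma vanishing0 : vanishing P (fun n _ => 0 : 'M[R]_(d n)).
Proof.
move=> E _; apply: aeW => w; under eq_fun do rewrite mulmx0 mxtrace0.
exact: cvg_cst.
Qed.

Lemma vanishing_add D1 D2 : vanishing P D1 -> vanishing P D2 ->
  vanishing P (fun n w => D1 n w + D2 n w).
Proof.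
move=> D10 D20 E stdE; apply: filterS2 (D10 _ stdE) (D20 _ stdE) => w h1 h2.
by under eq_fun do rewrite mulmxDr mxtraceD; rewrite -[0]addr0; exact: cvgD.
Qed.

Lemma vanishing_opp D : vanishing P D -> vanishing P (fun n w => - D n w).
Proof.
move=> D0 E /D0; apply: filterS => w h.
by under eq_fun do rewrite mulmxN raddfN /=; rewrite -[0]oppr0; exact: cvgN.
Qed.

Lemma standard_mulr (c : R) (E A : forall n, 'M[R]_(d n)) :
  0 < c -> (\forall n \near \oo, opbound c (A n)) ->
  standard E -> standard (fun n => E n *m A n).
Proof.
move=> c0 hA /bounded_seqP[M EM]; apply/bounded_seqP; exists (c * M).
apply: filterS2 hA EM => n hA EM.
by apply: le_trans (trace_norm_mulr_le _ c0 hA) _; rewrite ler_pM2l.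
Qed.

Lemma vanishing_mull (c : R) (A : forall n, 'M[R]_(d n)) D :
  0 < c -> (\forall n \near \oo, opbound c (A n)) ->
  vanishing P D -> vanishing P (fun n w => A n *m D n w).
Proof.
move=> c0 hA D0 E /(standard_mulr c0 hA) /D0; apply: filterS => w.
by under eq_fun do rewrite -mulmxA.
Qed.

Lemma vanishing_mull_random (A D : forall n, T -> 'M[R]_(d n)) :
  random_mxseq A -> random_mxseq D -> independent_mxseq P A D ->
  {ae P, forall w, exists2 c, 0 < c & \forall n \near \oo, opbound c (A n w)} ->
  vanishing P D -> vanishing P (fun n w => A n w *m D n w).
Proof.
move=> rA rD indep hA D0 E stdE.
pose T1 := g_sigma_algebraType (entry_events A).
pose T2 := g_sigma_algebraType (entry_events D).
have mentry (X : forall n, T -> 'M[R]_(d n)) n i j :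
    measurable_fun setT
      (fun w : g_sigma_algebraType (entry_events X) => X n w i j).
  apply: measurable_fun_open => U oU; apply: sub_gen_smallest.
  by exists n, i, j, U.
(* The two occurrences of the sample point are separated; the diagonal gives back the trace to be
   studied. *)
pose u n (w : T1 * T2) := \tr (E n *m (A n w.1 *m D n w.2)).
have mu n : measurable_fun setT (u n).
  have -> : u n = fun w => \sum_i \sum_k
      E n i k * \sum_j A n w.1 k j * D n w.2 j i.
    apply/funext => w; apply: eq_bigr => i _; rewrite mxE.
    by apply: eq_bigr => k _; rewrite mxE.
  apply: measurable_sum => i; apply: measurable_sum => k.
  apply: measurable_realfun.measurable_funM => //; apply: measurable_sum => j.
  apply: measurable_realfun.measurable_funM.
    exact: (measurableT_comp (mentry A n k j) measurable_fst).
  exact: (measurableT_comp (mentry D n j i) measurable_snd).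
have := ae_diagonal rA rD indep (measurable_cvg0 mu); apply.
(* With w1 fixed, the left factor is deterministic. *)
apply: filterS hA => w1 [c c0 hA].
exact: (vanishing_mull c0 hA D0).
Qed.

End Vanishing.

Section DetEquivParts.
Context (R : realType) (disp : measure_display) (T : measurableType disp).
Context (P : probability T R) (K : numFieldType) (iota : {rmorphism R -> K}).
Hypothesis le_iota : {mono iota : x y / x <= y}.
Variable s : scalar_parts iota.
Context (d : nat -> nat).
Implicit Types A B C D : forall n, T -> 'M[K]_(d n).

(** The test matrices are real, so Re tr(E D) = tr(E Re D), and likewise for Im. *)
Lemma det_equivP A B : det_equiv P iota A B <->
  vanishing P (fun n w => map_mx (re s) (A n w - B n w)) /\
  vanishing P (fun n w => map_mx (im s) (A n w - B n w)).
Proof.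
split=> [AB|[reAB imAB] E stdE].
  by split=> E /AB; apply: filterS => w /(cvg0_parts le_iota s)[h1 h2];
    [under eq_fun do rewrite -re_trace | under eq_fun do rewrite -im_trace].
apply: filterS2 (reAB _ stdE) (imAB _ stdE) => w h1 h2.
apply/(cvg0_parts le_iota s); split.
  by under eq_fun do rewrite re_trace.
by under eq_fun do rewrite im_trace.
Qed.

Lemma det_equiv_refl A : det_equiv P iota A A.
Proof.
by apply/det_equivP; split; apply: (vanishing_ext (@vanishing0 _ _ _ P d)) => n w;
  apply/matrixP => i j; rewrite !mxE subrr ?re0 ?im0.
Qed.

Lemma det_equiv_sym A B : det_equiv P iota A B -> det_equiv P iota B A.
Proof.
move=> /det_equivP[h1 h2]; apply/det_equivP; split.
  apply: (vanishing_ext (vanishing_opp h1)) => n w.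
  by rewrite !re_subr_mx opprB.
apply: (vanishing_ext (vanishing_opp h2)) => n w.
by rewrite !im_subr_mx opprB.
Qed.

Lemma det_equiv_trans A B C :
  det_equiv P iota A B -> det_equiv P iota B C -> det_equiv P iota A C.
Proof.
move=> /det_equivP[h1 h2] /det_equivP[h3 h4]; apply/det_equivP; split.
  apply: (vanishing_ext (vanishing_add h1 h3)) => n w.
  by rewrite !re_subr_mx addrA subrK.
apply: (vanishing_ext (vanishing_add h2 h4)) => n w.
by rewrite !im_subr_mx addrA subrK.
Qed.

Lemma det_equiv_add A B C D :
  det_equiv P iota A B -> det_equiv P iota C D ->
  det_equiv P iota (fun n w => A n w + C n w) (fun n w => B n w + D n w).
Proof.
move=> /det_equivP[h1 h2] /det_equivP[h3 h4]; apply/det_equivP; split.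
  apply: (vanishing_ext (vanishing_add h1 h3)) => n w.
  by apply/matrixP => i j; rewrite !mxE -re_add opprD addrACA.
apply: (vanishing_ext (vanishing_add h2 h4)) => n w.
by apply/matrixP => i j; rewrite !mxE -im_add opprD addrACA.
Qed.

Lemma bounded_op_norm_parts (A : forall n, 'M[K]_(d n)) :
  bounded_seq (fun n => op_norm iota (A n)) ->
  (exists2 c, 0 < c & \forall n \near \oo, opbound c (map_mx (re s) (A n))) /\
  (exists2 c, 0 < c & \forall n \near \oo, opbound c (map_mx (im s) (A n))).
Proof.
move=> /bounded_seqP[M AM].
(* The lemmas on [opbound] need a strictly positive constant. *)
have M0 : 0 < 1 + `|M| by rewrite ltr_pwDl.
have leM : M <= 1 + `|M| by rewrite (le_trans (ler_norm M))// lerDr.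
by split; exists (1 + `|M|) => //; apply: filterS AM => n AM;
  have [] := op_norm_opbound le_iota s (le_trans AM leM) (ltW M0).
Qed.

Lemma det_equiv_mull (A : forall n, 'M[K]_(d n)) B C :
  bounded_seq (fun n => op_norm iota (A n)) -> det_equiv P iota B C ->
  det_equiv P iota (fun n w => A n *m B n w) (fun n w => A n *m C n w).
Proof.
move=> /bounded_op_norm_parts[[c1 c10 h1] [c2 c20 h2]] /det_equivP[h3 h4].
apply/det_equivP; split.
  (* Re(A D) = Re A Re D - Im A Im D, each product being a real left multiplication. *)
  apply: (vanishing_ext (vanishing_add (vanishing_mull c10 h1 h3)
    (vanishing_opp (vanishing_mull c20 h2 h4)))) => n w.
  by rewrite -mulmxBr re_mulmx.
apply: (vanishing_ext (vanishing_add (vanishing_mull c10 h1 h4)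
  (vanishing_mull c20 h2 h3))) => n w.
by rewrite -mulmxBr im_mulmx.
Qed.

(** Preimages of open sets under f are open, so taking parts only shrinks the sigma-algebra;
    measurability and independence pass to the parts. *)
Lemma entry_events_map (f : K -> R) A : continuous f ->
  entry_events (fun n w => map_mx f (A n w)) `<=` entry_events A.
Proof.
move=> /continuousP cf _ [n [i [j [U [oU ->]]]]].
exists n, i, j, (f @^-1` U); split; first exact: cf.
by apply/seteqP; split=> w /=; rewrite mxE.
Qed.

Lemma random_map (f : K -> R) A : continuous f -> random_mxseq A ->
  random_mxseq (fun n w => map_mx f (A n w)).
Proof. by move=> cf; apply: subset_trans; exact: entry_events_map. Qed.

(** The map f is applied before subtracting, so that the difference is one of real measurable
    functions. *)
Lemma random_map_sub (f : K -> R) A B :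
  continuous f -> (forall x y, f (x - y) = f x - f y) ->
  random_mxseq A -> random_mxseq B ->
  random_mxseq (fun n w => map_mx f (A n w - B n w)).
Proof.
move=> cf fB rA rB _ [n [i [j [U [oU ->]]]]].
have mf (X : forall n, T -> 'M[K]_(d n)) :
    random_mxseq X -> measurable_fun setT (fun w => f (X n w i j)).
  move=> rX; apply: measurable_fun_open => V oV; apply: rX.
  exists n, i, j, (f @^-1` V); split=> //.
  by move/continuousP: cf; exact.
have := measurable_realfun.measurable_funB (mf A rA) (mf B rB).
move=> /(_ measurableT _ (measurable_realfun.open_measurable oU)).
rewrite setTI; congr measurable.
by apply/seteqP; split=> w /=; rewrite !mxE fB.
Qed.

Lemma independent_map (f g : K -> R) A B :
  continuous f -> continuous g -> independent_mxseq P A B ->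
  independent_mxseq P (fun n w => map_mx f (A n w)) (fun n w => map_mx g (B n w)).
Proof.
move=> cf cg indep F G hF hG; apply: indep.
  exact: (sub_sigma_algebra2 (entry_events_map cf) hF).
exact: (sub_sigma_algebra2 (entry_events_map cg) hG).
Qed.

Lemma det_equiv_mull_random A B C :
  random_mxseq A -> random_mxseq B -> random_mxseq C ->
  independent_mxseq P A (fun n w => B n w - C n w) ->
  {ae P, forall w, bounded_seq (fun n => op_norm iota (A n w))} ->
  det_equiv P iota B C ->
  det_equiv P iota (fun n w => A n w *m B n w) (fun n w => A n w *m C n w).
Proof.
move=> rA rB rC indep hA /det_equivP[hre him].
have cre : continuous (re s) by exact: continuous_re.
have cim : continuous (im s) by exact: continuous_im.
have reB x y : re s (x - y) = re s x - re s y by rewrite re_add re_opp.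
have imB x y : im s (x - y) = im s x - im s y by rewrite im_add im_opp.
(* Used for all four pairs of real and imaginary parts in the product. *)
have h f g : continuous f -> continuous g ->
    (forall x y, g (x - y) = g x - g y) ->
    {ae P, forall w, exists2 c, 0 < c &
       \forall n \near \oo, opbound c (map_mx f (A n w))} ->
    vanishing P (fun n w => map_mx g (B n w - C n w)) ->
    vanishing P (fun n w => map_mx f (A n w) *m map_mx g (B n w - C n w)).
  move=> cf cg gB hf hg; apply: vanishing_mull_random => //.
  - exact: random_map.
  - exact: random_map_sub.
  - exact: (independent_map cf cg indep).
have hAre : {ae P, forall w, exists2 c, 0 < c &
    \forall n \near \oo, opbound c (map_mx (re s) (A n w))}.
  by apply: filterS hA => w /bounded_op_norm_parts[].
have hAim : {ae P, forall w, exists2 c, 0 < c &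
    \forall n \near \oo, opbound c (map_mx (im s) (A n w))}.
  by apply: filterS hA => w /bounded_op_norm_parts[].
apply/det_equivP; split.
  apply: (vanishing_ext (vanishing_add (h _ _ cre cre reB hAre hre)
    (vanishing_opp (h _ _ cim cim imB hAim him)))) => n w.
  by rewrite -mulmxBr re_mulmx.
apply: (vanishing_ext (vanishing_add (h _ _ cre cim imB hAre him)
  (h _ _ cim cre reB hAim hre))) => n w.
by rewrite -mulmxBr im_mulmx.
Qed.

End DetEquivParts.

(** * Normalized traces and the theorem *)

Lemma standard_scalar_inv (R : realType) :
  standard (fun n => n%:R^-1%:M : 'M[R]_n).
Proof.
apply/bounded_seqP; exists 1; apply: nearW => n; exact: trace_norm_scalar_le1.
Qed.

Lemma det_equiv_trace (R : realType) (disp : measure_display)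
    (T : measurableType disp) (P : probability T R) (K : numFieldType)
    (iota : {rmorphism R -> K}) (A B : forall n, T -> 'M[K]_n) :
  det_equiv P iota A B ->
  cvg_as P (fun n w => \tr (n%:R^-1 *: A n w) - \tr (n%:R^-1 *: B n w)) 0.
Proof.
move=> /(_ _ (standard_scalar_inv R)); apply: filterS => w /norm_cvg0P.
under eq_fun do rewrite map_scalar_mx fmorphV rmorph_nat mul_scalar_mx
  scalerBr raddfB /=.
done.
Qed.

Theorem theorem4p3 (R : realType) (disp : measure_display)
    (T : measurableType disp) (P : probability T R) :
  (forall (K : numFieldType) (iota : R -> K), scalar_embedding iota ->
    (forall d : nat -> nat, d n @[n --> \oo] --> \oo ->
      (* equivalence relation *)
      [/\ (forall A : (forall n, T -> 'M[K]_(d n)), random_mxseq A ->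
             det_equiv P iota A A),
          (forall A B : (forall n, T -> 'M[K]_(d n)),
             random_mxseq A -> random_mxseq B ->
             det_equiv P iota A B -> det_equiv P iota B A) &
          (forall A B C : (forall n, T -> 'M[K]_(d n)),
             random_mxseq A -> random_mxseq B -> random_mxseq C ->
             det_equiv P iota A B -> det_equiv P iota B C ->
             det_equiv P iota A C)] /\
      (* sum *)
      (forall A B C D : (forall n, T -> 'M[K]_(d n)),
         random_mxseq A -> random_mxseq B ->
         random_mxseq C -> random_mxseq D ->
         det_equiv P iota A B -> det_equiv P iota C D ->
         det_equiv P iota (fun n w => A n w + C n w)
                          (fun n w => B n w + D n w)) /\
      (* product, deterministic left factor *)
      (forall (A : forall n, 'M[K]_(d n)) (B C : forall n, T -> 'M[K]_(d n)),
         random_mxseq B -> random_mxseq C ->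
         bounded_seq (fun n => op_norm iota (A n)) ->
         det_equiv P iota B C ->
         det_equiv P iota (fun n w => A n *m B n w)
                          (fun n w => A n *m C n w)) /\
      (* product, random left factor *)
      (forall A B C : (forall n, T -> 'M[K]_(d n)),
         random_mxseq A -> random_mxseq B -> random_mxseq C ->
         independent_mxseq P A (fun n w => B n w - C n w) ->
         {ae P, forall w, bounded_seq (fun n => op_norm iota (A n w))} ->
         det_equiv P iota B C ->
         det_equiv P iota (fun n w => A n w *m B n w)
                          (fun n w => A n w *m C n w))) /\
    (* trace *)
    (forall A B : (forall n, T -> 'M[K]_n),
       random_mxseq A -> random_mxseq B ->
       det_equiv P iota A B ->
       cvg_as P (fun n w => \tr (n%:R^-1 *: A n w) - \tr (n%:R^-1 *: B n w)) 0)) /\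
  (* Stieltjes transforms *)
  (forall (A B : forall n, T -> 'M[R]_n) (z : R[i]),
     random_mxseq A -> random_mxseq B ->
     (forall n w, (A n w)^T = A n w) -> (forall n w, (B n w)^T = B n w) ->
     (forall n w, shifted_mx (A n w) z \in unitmx) ->
     (forall n w, shifted_mx (B n w) z \in unitmx) ->
     det_equiv P (real_complex R) (fun n w => resolvent (A n w) z)
                                  (fun n w => resolvent (B n w) z) ->
     cvg_as P (fun n w => stieltjes (A n w) z - stieltjes (B n w) z) 0).
Proof.
split=> [K iota /scalar_embedding_parts[f [-> le_f [s]]]|].
  split=> [d _|A B _ _]; last exact: det_equiv_trace.
  split; first split.
  - by move=> A _; exact: (det_equiv_refl P le_f s).
  - by move=> A B _ _; exact: (det_equiv_sym le_f s).
  - by move=> A B C _ _ _; exact: (det_equiv_trans le_f s).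
  split; first by move=> A B C D _ _ _ _; exact: (det_equiv_add le_f s).
  split; first by move=> A B C _ _; exact: (det_equiv_mull le_f s).
  by move=> A B C; exact: (det_equiv_mull_random le_f s).
(* The trace item is applied to the resolvents, which are sequences over R[i]. *)
move=> A B z _ _ _ _ _ _ /det_equiv_trace.
apply: filterS => w; under eq_fun do rewrite !mxtraceZ.
done.
Qed.
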